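(* Let $p$ and $q$ be positive integers. A graph $G$ is $(p,q)$-clique-Helly if and only if every $(p+1,q)$-expansion in $G$ has at least $q$ universal vertices.
   Context: Graphs are finite, simple and undirected. A clique is a set of pairwise adjacent vertices; maximal means inclusion-wise maximal. The core of a family of sets is the intersection of its members. A family is $(p,q)$-intersecting if every nonempty subfamily of at most $p$ members has core of cardinality at least $q$, and has the $(p,q)$-Helly property if every nonempty $(p,q)$-intersecting subfamily has core of cardinality at least $q$. A graph is $(p,q)$-clique-Helly if the family of its maximal cliques has the $(p,q)$-Helly property. A vertex $v$ is complete to a vertex set $W$ if $v$ is adjacent to every vertex of $W-\{v\}$. Let $\mathcal Q$ be a family of $p+1$ pairwise different cliques of $G$ of cardinality $q$ each such that the union of any $p$ members of $\mathcal Q$ is a clique of $G$; the $(p+1,q)$-expansion of $\mathcal Q$ in $G$ is the subgraph of $G$ induced by the vertices of $G$ that are complete to at least $p$ members of $\mathcal Q$. A universal vertex of a graph is a vertex adjacent to all other vertices of that graph. *)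

(* Defs.v *)
From mathcomp Require Import all_boot.

Set Implicit Arguments.
Unset Strict Implicit.
Unset Printing Implicit Defensive.

Record sgraph := SGraph {
  vertex :> finType;
  adj : rel vertex;
  adj_sym : symmetric adj;
  adj_irrefl : irreflexive adj
}.

Definition induced_adj (G : sgraph) (S : {set G}) : rel {x : G | x \in S} :=
  fun x y => adj (val x) (val y).

Lemma induced_adj_sym (G : sgraph) (S : {set G}) : symmetric (induced_adj (S := S)).
Proof. by move=> x y; apply: adj_sym. Qed.

Lemma induced_adj_irrefl (G : sgraph) (S : {set G}) : irreflexive (induced_adj (S := S)).
Proof. by move=> x; apply: adj_irrefl. Qed.

Definition induced (G : sgraph) (S : {set G}) : sgraph :=
  SGraph (@induced_adj_sym G S) (@induced_adj_irrefl G S).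

Definition clique (G : sgraph) (A : {set G}) : bool :=
  [forall x in A, forall y in A, (x != y) ==> adj x y].

Definition max_cliques (G : sgraph) : {set {set G}} :=
  [set A : {set G} | maxset (@clique G) A].

Definition universal (G : sgraph) (v : G) : bool :=
  [forall w : G, (w != v) ==> adj v w].

Definition complete_to (G : sgraph) (v : G) (W : {set G}) : bool :=
  [forall w in W :\ v, adj v w].

(* The core of the empty family is [set: T]; it is only used on nonempty ones. *)
Definition core (T : finType) (F : {set {set T}}) : {set T} :=
  \bigcap_(A in F) A.

Definition intersecting (T : finType) (p q : nat) (F : {set {set T}}) : bool :=
  [forall H : {set {set T}},
    [&& H \subset F, H != set0 & #|H| <= p] ==> (q <= #|core H|)].

Definition Helly (T : finType) (p q : nat) (F : {set {set T}}) : bool :=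
  [forall H : {set {set T}},
    [&& H \subset F, H != set0 & intersecting p q H] ==> (q <= #|core H|)].

Definition clique_Helly (p q : nat) (G : sgraph) : bool :=
  Helly p q (max_cliques G).

(* The families of which the (p.+1, q)-expansion is defined. *)
Definition expandable (G : sgraph) (p q : nat) (Q : {set {set G}}) : bool :=
  [&& #|Q| == p.+1,
      [forall A in Q, clique A && (#|A| == q)] &
      [forall P : {set {set G}}, (P \subset Q) && (#|P| == p) ==> clique (cover P)]].

(* The (p.+1, q)-expansion of Q; q occurs only in expandable p q Q. *)
Definition expansion (G : sgraph) (p : nat) (Q : {set {set G}}) : sgraph :=
  induced [set v : G | p <= #|[set A in Q | complete_to v A]|].

(* Main.v *)
(* Necessity: let [F] be the family of the maximal cliques containing all but
   possibly one member of [Q]. Since [Q] has [p.+1] members, any [p] cliques of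
   [F] share a member of [Q], of size [q]. Hence the core of [F] has size at
   least [q], and each of its vertices is universal in the expansion.

   Sufficiency: let [F] be a smallest intersecting family of maximal cliques
   with core smaller than [q]. It has more than [p] members, and removing any
   member [A] leaves a core containing a [q]-set [f A]. The sets [f A], for
   [p.+1] choices of [A], are pairwise different and form an expandable family.
   Its expansion contains all members of [F], so by maximality each universal
   vertex of the expansion lies in the core of [F]. *)
Require Import Defs.
From mathcomp Require Import all_boot.

Lemma subset_of_card {T : finType} {n : nat} {A : {set T}} :
  n <= #|A| -> exists2 B : {set T}, B \subset A & #|B| = n.
Proof.
case/card_geqP=> s [s_uniq s_size sA]; exists [set x in s].
  by apply/subsetP=> x; rewrite inE; apply: sA.
by rewrite cardsE (card_uniqP s_uniq).
Qed.

(** * Cliques, maximal cliques and intersecting families *)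

Lemma cliqueP {G : sgraph} {A : {set G}} :
  reflect {in A &, forall x y, x != y -> adj x y} (clique A).
Proof.
apply: (iffP forall_inP) => [cA x y xA yA | cA x xA].
  by apply/implyP; move/forall_inP: (cA x xA); apply.
by apply/forall_inP=> y yA; apply/implyP; apply: cA.
Qed.

Lemma complete_toP {G : sgraph} {v : G} {W : {set G}} :
  reflect {in W, forall w, w != v -> adj v w} (complete_to v W).
Proof.
apply: (iffP forall_inP) => [cW w wW wv | cW w].
  by apply: cW; rewrite !inE wv.
by rewrite !inE => /andP[wv wW]; apply: cW.
Qed.

Lemma clique_sub {G : sgraph} {A B : {set G}} :
  A \subset B -> clique B -> clique A.
Proof.
by move=> /subsetP sAB /cliqueP cB; apply/cliqueP=> x y /sAB xB /sAB; apply: cB.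
Qed.

Lemma clique_complete_to {G : sgraph} {A B : {set G}} {v : G} :
  clique A -> v \in A -> B \subset A -> complete_to v B.
Proof.
move=> /cliqueP cA vA /subsetP sBA; apply/complete_toP=> w /sBA wA wv.
by apply: cA => //; rewrite eq_sym.
Qed.

Lemma clique_setU1 {G : sgraph} {v : G} {A : {set G}} :
  clique A -> complete_to v A -> clique (v |: A).
Proof.
move=> /cliqueP cA /complete_toP vA; apply/cliqueP=> x y.
case/setU1P=> [->|xA] /setU1P[->|yA]; rewrite ?eqxx // => xy.
- by apply: vA; rewrite // eq_sym.
- by rewrite adj_sym; apply: vA.
- exact: cA.
Qed.

Lemma clique_sub_max {G : sgraph} {A : {set G}} :
  clique A -> exists2 M, M \in max_cliques G & A \subset M.
Proof. by case/maxset_exists=> M maxM sAM; exists M; rewrite // inE. Qed.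

Lemma max_clique_clique {G : sgraph} {M : {set G}} :
  M \in max_cliques G -> clique M.
Proof. by rewrite inE => /maxsetp. Qed.

(** Otherwise [v |: M] would be a strictly larger clique. *)
Lemma max_clique_mem {G : sgraph} {M : {set G}} {v : G} :
  M \in max_cliques G -> complete_to v M -> v \in M.
Proof.
rewrite inE => /maxsetP[cM maxM] vM.
by rewrite -(maxM _ (clique_setU1 cM vM) (subsetU1 v M)) setU11.
Qed.

Lemma universalP {G : sgraph} {v : G} :
  reflect (forall w, w != v -> adj v w) (universal v).
Proof.
by apply: (iffP forallP) => uv w; [apply/implyP | apply/implyP; apply: uv].
Qed.

Lemma core_sub {T : finType} {F : {set {set T}}} {A : {set T}} :
  A \in F -> core F \subset A.
Proof. exact: bigcap_inf. Qed.

Lemma intersecting_sub {T : finType} {p q : nat} {F H : {set {set T}}} :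
  H \subset F -> intersecting p q F -> intersecting p q H.
Proof.
move=> sHF /forallP iF; apply/forallP=> K; apply/implyP=> /and3P[sKH K0 Kp].
by apply: (implyP (iF K)); rewrite (subset_trans sKH sHF) K0.
Qed.

Lemma exists_notin {T : finType} {A B : {set T}} :
  #|B| < #|A| -> exists2 x, x \in A & x \notin B.
Proof.
move=> ltBA; apply/subsetPn; apply/negP=> /subset_leq_card.
by rewrite leqNgt ltBA.
Qed.

Lemma expandable_intro {G : sgraph} {p q : nat} {Q : {set {set G}}} :
  #|Q| = p.+1 -> {in Q, forall A, clique A /\ #|A| = q} ->
  (forall P : {set {set G}}, P \subset Q -> #|P| = p -> clique (cover P)) ->
  expandable p q Q.
Proof.
move=> cardQ cQ cP; apply/and3P; split; first by rewrite cardQ.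
  by apply/forall_inP=> A /cQ[-> ->] /=.
by apply/forallP=> P; apply/implyP=> /andP[sPQ /eqP]; apply: cP.
Qed.

Lemma expandable_cover_clique {G : sgraph} {p q : nat} {Q : {set {set G}}}
    {A : {set G}} :
  expandable p q Q -> A \in Q -> clique (cover (Q :\ A)).
Proof.
case/and3P=> /eqP cardQ _ /forallP cQ AQ; apply: (implyP (cQ _)).
by rewrite subsetDl /=; move: (cardsD1 A Q); rewrite AQ cardQ add1n => -[<-].
Qed.

(** * Necessity: the maximal cliques around an expandable family *)

Definition covering_max_cliques {G : sgraph} (Q : {set {set G}}) :
    {set {set G}} :=
  [set M in max_cliques G | [exists A in Q, cover (Q :\ A) \subset M]].

Lemma covering_max_cliques_intersecting {G : sgraph} {p q : nat}
    {Q : {set {set G}}} :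
  expandable p q Q -> intersecting p q (covering_max_cliques Q).
Proof.
case/and3P=> /eqP cardQ /forall_inP Qq _.
apply/forallP=> H; apply/implyP=> /and3P[/subsetP sHF _ Hp].
have [g gP]: exists g : {set G} -> {set G},
    forall M, M \in H -> cover (Q :\ g M) \subset M.
  (* The choice function must be total, so [set0] serves as a dummy value outside [H]. *)
  apply: (@fin_all_exists _ (fun=> {set G})
            (fun M A => M \in H -> cover (Q :\ A) \subset M)) => M.
  have [/sHF|_] := boolP (M \in H); last by exists set0.
  by rewrite inE => /andP[_ /exists_inP[A _ sAM]]; exists A.
(* Pigeonhole: [g] takes at most [p] values on [H], so some [B] among the [p.+1] members of [Q] is
   omitted by no clique of [H]. *)
have [B BQ BgH]: exists2 B, B \in Q & B \notin g @: H.
  by apply: exists_notin; rewrite cardQ ltnS (leq_trans (leq_imset_card _ _)).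
have /andP[_ /eqP <-] := Qq B BQ; apply/subset_leq_card/bigcapsP=> M MH.
apply: subset_trans (gP M MH); apply: bigcup_sup; rewrite !inE BQ andbT.
by apply: contraNneq BgH => ->; apply: imset_f.
Qed.

(** A vertex [w] of the expansion forms a clique with the union of [p] members of [Q]. A maximal
    clique extending it belongs to the family, so it contains both [w] and any vertex [v] of the
    core. *)
Lemma core_covering_universal {G : sgraph} {p q : nat} {Q : {set {set G}}} :
  0 < p -> expandable p q Q ->
  core (covering_max_cliques Q)
    \subset val @: [set v : expansion p Q | universal v].
Proof.
move=> p_gt0 expQ; have /and3P[/eqP cardQ _ _] := expQ.
have clique_mem v B (C : {set G}) :
    v \in core (covering_max_cliques Q) -> B \in Q ->
    cover (Q :\ B) \subset C -> clique C ->
    exists M, [/\ clique M, v \in M & C \subset M].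
  move=> vF BQ sBC cC; have [M maxM sCM] := clique_sub_max cC.
  exists M; split=> //; first exact: max_clique_clique.
  apply: (subsetP (core_sub _)) vF; rewrite inE maxM; apply/exists_inP.
  by exists B => //; apply: subset_trans sCM.
apply/subsetP=> v vF.
(* This places [v] in the expansion. As [p] is positive, [Q] has a member [B] other than [A], and
   then [A] lies in [cover (Q :\ B)]. *)
have vQ A : A \in Q -> complete_to v A.
  move=> AQ; have [B BQ BA]: exists2 B, B \in Q & B \notin [set A].
    by apply: exists_notin; rewrite cards1 cardQ.
  have [M [cM vM sM]] :=
    clique_mem v B _ vF BQ (subxx _) (expandable_cover_clique expQ BQ).
  apply: clique_complete_to cM vM _; apply: subset_trans sM.
  by apply: bigcup_sup; rewrite !inE AQ eq_sym andbT; rewrite inE in BA.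
have vS : v \in [set v : G | p <= #|[set A in Q | complete_to v A]|].
  rewrite inE (leq_trans (leqnSn p)) // -cardQ subset_leq_card //.
  by apply/subsetP=> A AQ; rewrite inE AQ vQ.
apply/imsetP; exists (Sub v vS : expansion p Q); last by rewrite SubK.
rewrite inE; apply/universalP=> w wv.
have := valP w; rewrite inE => /subset_of_card[P /subsetP sP cardP].
have [B BQ BP]: exists2 B, B \in Q & B \notin P.
  by apply: exists_notin; rewrite cardP cardQ.
have eP : Q :\ B = P.
  apply/esym/eqP; rewrite eqEcard cardP; apply/andP; split.
    apply/subsetP=> A AP; have := sP A AP; rewrite !inE => /andP[-> _].
    by rewrite andbT; apply: contraNneq BP => <-.
  by move: (cardsD1 B Q); rewrite BQ cardQ add1n => -[<-].
have wP : complete_to (val w) (cover (Q :\ B)).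
  apply/complete_toP=> x; rewrite eP => /bigcupP[A /sP].
  by rewrite inE => /andP[_ /complete_toP wA]; apply: wA.
have [M [/cliqueP cM vM sM]] := clique_mem v B _ vF BQ
  (subsetU1 (val w) _) (clique_setU1 (expandable_cover_clique expQ BQ) wP).
rewrite /= /induced_adj /=; apply: cM => //.
  by apply: (subsetP sM); rewrite setU11.
by rewrite eq_sym.
Qed.

Lemma clique_Helly_expansion {G : sgraph} {p q : nat} {Q : {set {set G}}} :
  0 < p -> clique_Helly p q G -> expandable p q Q ->
  q <= #|[set v : expansion p Q | universal v]|.
Proof.
move=> p_gt0 /forallP hG expQ.
rewrite -(card_imset _ (@val_inj _ _ _)).
apply: leq_trans (subset_leq_card (core_covering_universal p_gt0 expQ)).
apply: (implyP (hG _)); rewrite covering_max_cliques_intersecting // andbT.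
apply/andP; split; first by apply/subsetP=> M; rewrite inE => /andP[].
have /and3P[/eqP cardQ _ _] := expQ.
have /card_gt0P[A AQ] : 0 < #|Q| by rewrite cardQ.
have [M maxM sM] := clique_sub_max (expandable_cover_clique expQ AQ).
apply/set0Pn; exists M; rewrite inE maxM; apply/exists_inP.
by exists A.
Qed.

(** * Sufficiency: an expansion built from a minimal counterexample *)

(** Each vertex of [M] is complete to every clique inside [M], so [M] lies in the expansion. Hence
    [v] is complete to [M], and maximality applies. *)
Lemma universal_expansion_mem {G : sgraph} {p : nat} {Q : {set {set G}}}
    {v : expansion p Q} {M : {set G}} :
  M \in max_cliques G -> p <= #|[set A in Q | A \subset M]| -> universal v ->
  val v \in M.
Proof.
move=> maxM pM /universalP uv; apply: (max_clique_mem maxM).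
apply/complete_toP=> w wM wv.
have wS : w \in [set v : G | p <= #|[set A in Q | complete_to v A]|].
  rewrite inE (leq_trans pM) // subset_leq_card //; apply/subsetP=> A.
  rewrite !inE => /andP[-> sAM] /=.
  exact: clique_complete_to (max_clique_clique maxM) wM sAM.
by have := uv (Sub w wS) wv; rewrite /= /induced_adj SubK.
Qed.

Lemma expansion_clique_Helly {G : sgraph} {p q : nat} :
  0 < p ->
  (forall Q : {set {set G}}, expandable p q Q ->
     q <= #|[set v : expansion p Q | universal v]|) ->
  clique_Helly p q G.
Proof.
move=> p_gt0 expG; apply/forallP=> F0; apply/implyP.
(* Strong induction on the size of the family plays the role of a smallest counterexample. *)
have [n] := ubnP #|F0|; elim: n F0 => // n IHn F leFn /and3P[/subsetP sF F0 iF].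
rewrite ltnS in leFn.
have [Fp|pF] := leqP #|F| p.
  by move/forallP: iF => /(_ F)/implyP; rewrite subxx F0; apply.
have [//|coreF] := leqP q #|core F|.
have [f fP]: exists f : {set G} -> {set G}, forall A, A \in F ->
    (f A \subset core (F :\ A)) /\ #|f A| = q.
  apply: (@fin_all_exists _ (fun=> {set G}) (fun A S => A \in F ->
    (S \subset core (F :\ A)) /\ #|S| = q)) => A.
  have [AF|_] := boolP (A \in F); last by exists set0.
  have cardFA : #|F| = #|F :\ A|.+1 by rewrite (cardsD1 A F) AF.
  have /subset_of_card[S sS cardS] : q <= #|core (F :\ A)|.
    apply: IHn; first by rewrite -cardFA.
    apply/and3P; split.
    - by apply/subsetP=> B /setD1P[_ /sF].
    - by rewrite -card_gt0 -ltnS -cardFA (leq_ltn_trans p_gt0).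
    - exact: intersecting_sub (subsetDl _ _) iF.
  by exists S.
have f_sub A B : A \in F -> B \in F -> A != B -> f A \subset B.
  move=> /fP[sfA _] BF AB; apply: subset_trans sfA (core_sub _).
  by rewrite !inE BF eq_sym AB.
(* Since [f A] lies in all other members of [F], it would otherwise lie in the core, which has fewer
   than [q] vertices. *)
have f_nsub A : A \in F -> ~~ (f A \subset A).
  move=> AF; apply: contraL coreF => sfA; have [_ <-] := fP A AF.
  rewrite -leqNgt; apply/subset_leq_card/bigcapsP=> B BF.
  by have [<- //|AB] := eqVneq A B; apply: f_sub.
have f_inj : {in F &, injective f}.
  move=> A B AF BF efAB; apply: contraNeq (f_nsub A AF) => AB.
  by rewrite efAB f_sub // eq_sym.
have [T /subsetP sTF cardT] := subset_of_card pF.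
have cardfT : #|f @: T| = p.+1.
  by rewrite card_in_imset // => A B /sTF AF /sTF; apply: f_inj.
have expT : expandable p q (f @: T).
  apply: expandable_intro => // [_ /imsetP[A AT ->]|P /subsetP sP cardP].
    have [_ ->] := fP A (sTF A AT); split=> //.
    have [B BT BA]: exists2 B, B \in T & B \notin [set A].
      by apply: exists_notin; rewrite cards1 cardT.
    apply: clique_sub (max_clique_clique (sF B (sTF B BT))).
    by apply: f_sub; rewrite ?sTF //; rewrite inE eq_sym in BA.
  (* Some [f A] is missing from [P]; all members of [P] are then of the form [f B] with [B]
     different from [A], hence lie in the clique [A]. *)
  have [_ /imsetP[A AT ->] fAP]: exists2 B, B \in f @: T & B \notin P.
    by apply: exists_notin; rewrite cardP cardfT.
  apply: clique_sub (max_clique_clique (sF A (sTF A AT))).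
  apply/bigcupsP=> S SP; have /imsetP[B BT eS] := sP S SP.
  rewrite eS; apply: f_sub; rewrite ?sTF //.
  by apply: contraNneq fAP => <-; rewrite -eS.
move: coreF; rewrite ltnNge => /negP[]; apply: leq_trans (expG _ expT) _.
rewrite -(card_imset _ (@val_inj _ _ _)); apply/subset_leq_card/subsetP.
move=> _ /imsetP[v + ->]; rewrite inE => uv; apply/bigcapP=> M MF.
apply: universal_expansion_mem (sF M MF) _ uv.
(* Whether or not [M] is in [T], at least [p] members of [T] differ from [M], and their images under
   [f] are distinct subsets of [M]. *)
have pTM : p <= #|f @: (T :\ M)|.
  rewrite card_in_imset; last first.
    by move=> A B /setD1P[_ /sTF AF] /setD1P[_ /sTF]; apply: f_inj.
  by rewrite -ltnS -cardT (cardsD1 M T) -add1n leq_add2r leq_b1.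
apply: leq_trans pTM _; apply/subset_leq_card/subsetP=> _ /imsetP[A + ->].
case/setD1P=> AM AT; rewrite inE imset_f //=.
exact: f_sub (sTF A AT) MF AM.
Qed.

Theorem theorem3p5 (p q : nat) (G : sgraph) (p_gt0 : 0 < p) (q_gt0 : 0 < q) :
  clique_Helly p q G <->
  (forall Q : {set {set G}}, expandable p q Q ->
     q <= #|[set v : expansion p Q | universal v]|).
Proof.
split=> [hG Q|]; first exact: clique_Helly_expansion.
exact: expansion_clique_Helly.
Qed.
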